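(* Let $k<n$ be natural numbers. The spectrum of $T_{n,k}=K_k\lor\overline{K_{n-k}}$ is \[ \sigma(T_{n,k})=\left\{(\lambda_2),\,(-1)^{k-1},\,(0)^{n-k-1},\,(\lambda_1)\right\}, \] where \[ \lambda_1,\lambda_2=\frac{(k-1)\pm\sqrt{(k-1)^2+4k(n-k)}}{2} \] (with $+$ for $\lambda_1$ and $-$ for $\lambda_2$).
   Context: All graphs are finite, simple and undirected; natural numbers are positive. $K_m$ is the complete graph on $m$ vertices, $\overline{K_m}$ is the empty graph (no edges) on $m$ vertices, and the join $G_1\lor G_2$ is obtained from the disjoint union of $G_1$ and $G_2$ by connecting every vertex of $G_1$ to every vertex of $G_2$. The spectrum $\sigma(G)$ of a graph $G$ is the multiset of eigenvalues of its $(0,1)$ adjacency matrix. In the notation $\{(a_1)^{m_1},(a_2)^{m_2},\dots\}$ for a multiset, $m_i$ is the multiplicity of $a_i$ (omitted when equal to $1$); if some of the listed values coincide, their multiplicities are added. *)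

(* Defs.v *)
From mathcomp Require Import all_boot all_order all_algebra.
From mathcomp Require Import finmap multiset.

Set Implicit Arguments.
Unset Strict Implicit.
Unset Printing Implicit Defensive.

Import GRing.Theory.

Local Open Scope ring_scope.
Local Open Scope mset_scope.

Record sgraph := SGraph {
  vertex :> finType;
  adj : rel vertex;
  adj_sym : symmetric adj;
  adj_irrefl : irreflexive adj }.

Fact complete_sym m : symmetric (fun i j : 'I_m => i != j).
Proof. by move=> i j; rewrite eq_sym. Qed.

Fact complete_irrefl m : irreflexive (fun i j : 'I_m => i != j).
Proof. by move=> i; rewrite eqxx. Qed.

Definition complete_graph (m : nat) : sgraph :=
  SGraph (@complete_sym m) (@complete_irrefl m).

Fact empty_sym m : symmetric (fun _ _ : 'I_m => false).
Proof. by []. Qed.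

Fact empty_irrefl m : irreflexive (fun _ _ : 'I_m => false).
Proof. by []. Qed.

Definition empty_graph (m : nat) : sgraph :=
  SGraph (@empty_sym m) (@empty_irrefl m).

Definition join_rel (G H : sgraph) : rel (G + H)%type := fun u v =>
  match u, v with
  | inl x, inl y => adj x y
  | inr x, inr y => adj x y
  | _, _ => true
  end.

Fact join_sym (G H : sgraph) : symmetric (@join_rel G H).
Proof. by case=> x [] y //=; rewrite adj_sym. Qed.

Fact join_irrefl (G H : sgraph) : irreflexive (@join_rel G H).
Proof. by case=> x /=; rewrite adj_irrefl. Qed.

Definition join_graph (G H : sgraph) : sgraph :=
  SGraph (@join_sym G H) (@join_irrefl G H).

Definition T_graph (n k : nat) : sgraph :=
  join_graph (complete_graph k) (empty_graph (n - k)%N).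

(* Vertices are numbered by [enum_val]; another numbering conjugates the matrix
   by a permutation. *)
Definition adjacency_mx (C : nzRingType) (G : sgraph) : 'M[C]_#|G| :=
  \matrix_(i, j) (adj (enum_val i) (enum_val j))%:R.

(* Eigenvalues are counted with algebraic multiplicity. The characteristic
   polynomial is monic, so it is the product of the 'X - z over the chosen
   sequence, which is unique up to order. *)
Definition mx_spectrum (C : closedFieldType) (m : nat) (A : 'M[C]_m) :
    {mset C} :=
  seq_mset (sval (closed_field_poly_normal (char_poly A))).

Definition spectrum (C : closedFieldType) (G : sgraph) : {mset C} :=
  mx_spectrum (adjacency_mx C G).

(* Main.v *)
(** By Schur complements, the characteristic polynomial of the block adjacency
    matrix of [T_graph n k], with [m = n - k], reduces to the determinant of a
    scalar matrix minus a rank-one matrix of size [k].  This gives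
    [(X + 1)^(k-1) X^(m-1) (X^2 - (k-1) X - k m)], whose quadratic factor has
    roots [lambda1] and [lambda2]. *)
Require Import Defs.
From mathcomp Require Import all_boot all_order all_algebra.
From mathcomp Require Import finmap multiset.
From mathcomp Require Import perm ring.
Import GRing.Theory Num.Theory.
Local Open Scope ring_scope.
Local Open Scope mset_scope.

(** A product of monic linear factors determines its roots up to order, and monicity removes the
    leading coefficient. *)
Lemma mx_spectrum_prod_XsubC {C : closedFieldType} {m : nat} (A : 'M[C]_m)
    (s : seq C) :
  char_poly A = \prod_(z <- s) ('X - z%:P) -> mx_spectrum A = seq_mset s.
Proof.
rewrite /mx_spectrum; case: closed_field_poly_normal => r /= def_r def_s.
apply/eq_seq_msetP/prod_XsubC_eq; rewrite -def_s def_r.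
by rewrite (monicP (char_poly_monic A)) scale1r.
Qed.

(** The change of numbering permutes rows and columns alike, so its sign enters squared. The sizes
    [p] and [q] need not be convertible, as with [#|G|] and a sum of block sizes. *)
Lemma det_reindex {R : comNzRingType} {T : Type} {p q : nat}
    {f : 'I_p -> T} {g : 'I_q -> T} (F : T -> T -> R) :
    bijective f -> bijective g ->
  \det (\matrix_(i, j) F (f i) (f j)) = \det (\matrix_(i, j) F (g i) (g j)).
Proof.
move=> bij_f [g' gK g'K].
have bij_h : bijective (g' \o f) by apply: bij_comp => //; exists g.
have eq_pq : p = q by have := bij_eq_card bij_h; rewrite !card_ord.
case: q / eq_pq g g' gK g'K bij_h => g g' gK g'K bij_h.
pose s := perm (bij_inj bij_h).
set A := \matrix_(i, j) F (g i) (g j).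
have ->: \matrix_(i, j) F (f i) (f j) = row_perm s (col_perm s A).
  by apply/matrixP=> i j; rewrite !mxE !permE /= !g'K.
rewrite row_permE col_permE !det_mulmx !det_perm odd_permV.
by rewrite mulrCA -expr2 sqrr_sign mulr1.
Qed.

(** Schur complement without division: right multiplication by a block triangular matrix clears [C],
    and the powers of [d] replace an inverse. *)
Lemma det_block_scalar_dr {R : comNzRingType} {p q : nat} (A : 'M[R]_p)
    (B : 'M[R]_(p, q)) (C : 'M[R]_(q, p)) (d : R) :
  \det (block_mx A B C d%:M) * d ^+ p = \det (d *: A - B *m C) * d ^+ q.
Proof.
have <-: \det (block_mx d%:M 0 (- C) 1%:M) = d ^+ p.
  by rewrite det_lblock !det_scalar expr1n mulr1.
rewrite -det_mulmx mulmx_block !mulmx0 !add0r !mulmx1.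
rewrite !mul_mx_scalar mul_scalar_mx !mulmxN scalerN subrr.
by rewrite det_ublock det_scalar.
Qed.

Lemma det_block_scalar_ul {R : comNzRingType} {p q : nat} (a : R)
    (B : 'M[R]_(p, q)) (C : 'M[R]_(q, p)) (D : 'M[R]_q) :
  a ^+ q * \det (block_mx a%:M B C D) = a ^+ p * \det (a *: D - C *m B).
Proof.
have <-: \det (block_mx 1%:M 0 (- C) a%:M) = a ^+ q.
  by rewrite det_lblock !det_scalar expr1n mul1r.
rewrite -det_mulmx mulmx_block !mul0mx !addr0 !mul1mx.
rewrite !mul_scalar_mx mul_mx_scalar mulNmx scalerN addNr addrC.
by rewrite det_ublock det_scalar.
Qed.

(** Eliminating either diagonal block of the bordered matrix with blocks [c%:M], [u], [v], [1] gives
    the same determinant, up to a factor [c] that cancels. *)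
Lemma det_scalar_sub_rank1 {R : idomainType} {p : nat} (c : R)
    (u : 'cV[R]_p.+1) (v : 'rV[R]_p.+1) : c != 0 ->
  \det (c%:M - u *m v) = c ^+ p * (c - (v *m u) 0 0).
Proof.
move=> c_neq0; apply: (mulfI c_neq0).
have := det_block_scalar_dr c%:M u v 1.
rewrite !expr1n !mulr1 scale1r => <-.
have := det_block_scalar_ul c u v 1%:M; rewrite expr1 => ->.
by rewrite det_mx11 exprS mulrA !mxE eqxx mulr1n mulr1.
Qed.

Lemma char_poly_T_graph {R : idomainType} (n k : nat) :
    (0 < k)%N -> (k < n)%N ->
  char_poly (adjacency_mx R (T_graph n k)) =
    ('X + 1) ^+ (k - 1) * 'X ^+ (n - k - 1)
      * ('X ^+ 2 - (k%:R - 1) * 'X - k%:R * (n%:R - k%:R)).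
Proof.
move=> k_gt0 lt_kn.
(* Now [n] enters only through [n - k], which can be generalised to a successor. *)
have -> : (n%:R - k%:R : {poly R}) = (n - k)%:R by rewrite natrB // ltnW.
have : (0 < n - k)%N by rewrite subn_gt0.
rewrite /T_graph; case: (n - k)%N => // m _; case: k k_gt0 {lt_kn} => // k _.
rewrite !subn1 /=.
set G := join_graph _ _.
pose F (x y : G) : {poly R} := 'X *+ (x == y) - (adj x y)%:R.
have -> : char_poly (adjacency_mx R G) =
    \det (\matrix_(i < #|G|, j < #|G|) F (enum_val i) (enum_val j)).
  congr (\det _); apply/matrixP=> i j.
  by rewrite !mxE /F (inj_eq enum_val_inj) rmorph_nat.
(* Numbering by [split] lists the clique first, which exposes the blocks. *)
rewrite (@det_reindex _ _ _ _ _ (@split k.+1 m.+1) F); last first.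
- by exists unsplit; [apply: splitK | apply: unsplitK].
- by exists enum_rank; [apply: enum_valK | apply: enum_rankK].
pose J (p q : nat) : 'M[{poly R}]_(p, q) := const_mx 1.
have -> : \matrix_(i, j) F (split i) (split j) =
    block_mx (('X + 1)%:M - J k.+1 k.+1) (- J _ _) (- J _ _) 'X%:M.
  apply/matrixP=> i j; rewrite !mxE.
  case: split_ordP => i' _; rewrite !mxE; case: split_ordP => j' _;
    rewrite !mxE /F /= ?(inj_eq inl_inj) ?(inj_eq inr_inj) ?subr0 ?sub0r //.
  by case: eqP => _ /=; rewrite ?mulr1n ?mulr0n; ring.
have X_neq0 : 'X != 0 :> {poly R} by rewrite polyX_eq0.
have X1_neq0 : 'X + 1 != 0 :> {poly R} by rewrite -size_poly_gt0 size_XaddC.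
(* The factor ['X ^+ k.+1] allows eliminating the block ['X%:M] over polynomials. *)
apply: (mulIf (expf_neq0 k.+1 X_neq0)); rewrite det_block_scalar_dr.
(* The product of the two off-diagonal all-ones blocks is [m.+1] times the all-ones matrix; ['X]
   comes from the clique block. *)
pose u : 'cV[{poly R}]_k.+1 := const_mx ('X + m.+1%:R).
have -> : 'X *: (('X + 1)%:M - J k.+1 k.+1) - - J k.+1 m.+1 *m - J m.+1 k.+1 =
    ('X * ('X + 1))%:M - u *m J 1 k.+1.
  rewrite scalerBr scale_scalar_mx -addrA -opprD mulNmx mulmxN opprK.
  congr (_ - _); apply/matrixP=> i j; rewrite !mxE big_ord1 !mxE !mulr1.
  congr (_ + _); under eq_bigr do rewrite !mxE mulr1.
  by rewrite sumr_const card_ord.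
rewrite det_scalar_sub_rank1 ?mulf_neq0 //.
have -> : (J 1 k.+1 *m u) 0 0 = k.+1%:R * ('X + m.+1%:R).
  rewrite mxE; under eq_bigr do rewrite !mxE mul1r.
  by rewrite sumr_const card_ord mulr_natl.
by rewrite exprMn !exprS; ring.
Qed.

Theorem theorem5p1 (C : numClosedFieldType) (n k : nat)
    (hk : (0 < k)%N) (hkn : (k < n)%N) :
  let D : C := (k%:R - 1) ^+ 2 + 4 * k%:R * (n%:R - k%:R) in
  let lambda1 : C := (k%:R - 1 + sqrtC D) / 2 in
  let lambda2 : C := (k%:R - 1 - sqrtC D) / 2 in
  spectrum C (T_graph n k) =
    [mset lambda2] `+` @msetn C (k - 1)%N (-1)
      `+` @msetn C (n - k - 1)%N 0 `+` [mset lambda1].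
Proof.
move=> D lambda1 lambda2.
pose s := lambda2 :: nseq (k - 1) (-1) ++ nseq (n - k - 1) 0 ++ [:: lambda1].
rewrite /spectrum (mx_spectrum_prod_XsubC _ s); last first.
  rewrite char_poly_T_graph // big_cons !big_cat big_seq1 !big_nseq !iter_mulr_1.
  rewrite polyC0 subr0 polyCN opprK.
  have sum_lambda : lambda1 + lambda2 = k%:R - 1 by rewrite /lambda1 /lambda2; field.
  have prod_lambda : lambda1 * lambda2 = - (k%:R * (n%:R - k%:R)).
    have -> : lambda1 * lambda2 = ((k%:R - 1) ^+ 2 - sqrtC D ^+ 2) / 4.
      by rewrite /lambda1 /lambda2; field.
    by rewrite sqrtCK /D; field.
  (* From here only the sum and product of the two roots matter. *)
  clearbody lambda1 lambda2.
  have -> : 'X ^+ 2 - (k%:R - 1) * 'X - k%:R * (n%:R - k%:R) =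
      ('X - lambda1%:P) * ('X - lambda2%:P).
    have -> : k%:R - 1 = (lambda1 + lambda2)%:P.
      by rewrite sum_lambda rmorphB rmorph_nat rmorph1.
    have -> : k%:R * (n%:R - k%:R) = - (lambda1 * lambda2)%:P.
      by rewrite prod_lambda rmorphN opprK rmorphM rmorphB !rmorph_nat.
    by rewrite polyCD polyCM; ring.
  by rewrite polyC1 /=; ring.
(* Comparing multiplicities pointwise also covers coinciding values, such as [lambda2 = -1] when
   [n - k = 1]. *)
apply/msetP=> z; rewrite mset_seqE !msetE2 !msetnE /= !count_cat !count_nseq /=.
rewrite ![_ == z]eq_sym.
by do !case: eqP => _ /=; rewrite ?mul1n ?mul0n ?addn0 ?add0n ?addnA.
Qed.
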